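(* Let $f\in C^{\infty}_{W,V}(\mathbb{T})$ be a function such that, for all $n$, $$\max\left\{\|D^{(2n)}_{W,V}f\|_{\infty},\|D^{(2n+1)}_{W,V}f\|_{\infty}\right\}\le c_{n},\qquad\text{where } c_{n}=o\left(\frac{n!}{e^{n}}\right).$$ Then $$f(x)=f(0)+\sum_{k=1}^{\infty}\left[D^{(k)}_{W,V}f(0)\right]F_{k}(x,x),$$ and the convergence is uniform in $x\in\mathbb{T}$. Moreover, the conditions that $f$ and its derivatives $D^{(n)}_{W,V}f$ must satisfy in order to be well defined on the torus, and which therefore hold, are $$\sum_{k=1}^{\infty}D^{(k)}_{W,V}f(0)F_{k}(1,1)=0,\quad \sum_{k=1}^{\infty}D^{(k+1)}_{W,V}f(0)G_{k}(1,1)=0,\quad \sum_{k=1}^{\infty}D^{(k+2)}_{W,V}f(0)F_{k}(1,1)=0,\ \ldots,$$ i.e. $\sum_{k\ge1}D^{(k+j)}_{W,V}f(0)F_k(1,1)=0$ for every even $j\ge0$ and $\sum_{k\ge1}D^{(k+j)}_{W,V}f(0)G_k(1,1)=0$ for every odd $j\ge1$.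
   Context: Setting. $\mathbb{T}=\mathbb{R}/\mathbb{Z}$, identified with $[0,1)$ with tagged point $0$. Càdlàg = right-continuous with left limits; càglàd = left-continuous with right limits. $W,V:\mathbb{R}\to\mathbb{R}$ are strictly increasing, $W$ càdlàg, $V$ càglàd, with $W(x+1)-W(x)=W(1)-W(0)$ and $V(x+1)-V(x)=V(1)-V(0)$ for all $x$; both are continuous at $0$ and $W(0)=V(0)=0$. They induce finite Borel measures with $dW((a,b])=W(b)-W(a)$, $dV([a,b))=V(b)-V(a)$ (atoms allowed). One-sided derivatives: $D_W^-f(x)=\lim_{h\to0^-}\frac{f(x+h)-f(x)}{W(x+h)-W(x)}$, $D_V^+g(x)=\lim_{h\to0^+}\frac{g(x+h)-g(x)}{V(x+h)-V(x)}$, required to exist at every $x\in\mathbb{T}$. $D^{(0)}_{W,V}f=f$, $D^{(1)}_{W,V}=D_W^-$, $D^{(2)}_{W,V}=D_V^+D_W^-$, $D^{(3)}_{W,V}=D_W^-D_V^+D_W^-$, and so on alternately ($n$ factors, $D_W^-$ applied first). $C^\infty_{W,V}(\mathbb{T})=\langle1\rangle\oplus C^\infty_{W,V,0}(\mathbb{T})$ (constants added), where $C^\infty_{W,V,0}(\mathbb{T})$ is the set of càdlàg $f:\mathbb{T}\to\mathbb{R}$ with $\int_{\mathbb{T}}f\,dV=0$ such that for all $n\ge1$ the function $D^{(n)}_{W,V}f$ exists and is: càglàd with zero $dW$-integral if $n$ is odd; càdlàg with zero $dV$-integral if $n$ is even. Generalized polynomials, for $x,s\in[0,1]$: $F_1(x,s)=W(s)$,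 $G_1(x,s)=V(s)$, and for $n\ge2$ $F_n(x,s)=\int_{[0,s)}[F_{n-1}(x,x)-F_{n-1}(x,\xi)]\,dV(\xi)$ for $n$ even, $F_n(x,s)=\int_{(0,s]}[F_{n-1}(x,x)-F_{n-1}(x,\xi)]\,dW(\xi)$ for $n$ odd; $G_n(x,s)=\int_{(0,s]}[G_{n-1}(x,x)-G_{n-1}(x,\xi)]\,dW(\xi)$ for $n$ even, $G_n(x,s)=\int_{[0,s)}[G_{n-1}(x,x)-G_{n-1}(x,\xi)]\,dV(\xi)$ for $n$ odd. *)

(* Defs.v *)
From HB Require Import structures.
From mathcomp Require Import all_boot all_order all_algebra.
From mathcomp Require Import all_classical all_reals all_analysis.

Set Implicit Arguments.
Unset Strict Implicit.
Unset Printing Implicit Defensive.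

Import Order.TTheory GRing.Theory Num.Theory.
Import numFieldNormedType.Exports.

Local Open Scope classical_set_scope.
Local Open Scope ring_scope.

(* Functions on the torus R/Z are represented by 1-periodic functions on R; the
   torus itself, as a domain of integration or of uniform convergence, is the
   fundamental domain [0, 1[. *)

Definition cadlag (R : realType) (f : R -> R) : Prop :=
  forall x, f y @[y --> x^'+] --> f x /\ cvg (f y @[y --> x^'-]).

Definition caglad (R : realType) (f : R -> R) : Prop :=
  forall x, f y @[y --> x^'-] --> f x /\ cvg (f y @[y --> x^'+]).

Definition quotient_wrt (R : realType) (U f : R -> R) (x h : R) : R :=
  (f (x + h) - f x) / (U (x + h) - U x).

(* [lim] is total: the existence of the derivatives below is expressed
   separately, by [left_derivable] and [right_derivable]. *)
Definition left_derivable (R : realType) (U f : R -> R) : Prop :=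
  forall x, cvg (quotient_wrt U f x h @[h --> 0^'-]).

Definition left_derivative (R : realType) (U f : R -> R) (x : R) : R :=
  lim (quotient_wrt U f x h @[h --> 0^'-]).

Definition right_derivable (R : realType) (U f : R -> R) : Prop :=
  forall x, cvg (quotient_wrt U f x h @[h --> 0^'+]).

Definition right_derivative (R : realType) (U f : R -> R) (x : R) : R :=
  lim (quotient_wrt U f x h @[h --> 0^'+]).

Fixpoint derivWV (R : realType) (W V : R -> R) (n : nat) (f : R -> R) : R -> R :=
  if n is m.+1 then
    if odd n then left_derivative W (derivWV W V m f)
    else right_derivative V (derivWV W V m f)
  else f.

Fixpoint derivableWV (R : realType) (W V : R -> R) (n : nat) (f : R -> R) : Prop :=
  if n is m.+1 then
    derivableWV W V m f /\
    if odd n then left_derivable W (derivWV W V m f)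
    else right_derivable V (derivWV W V m f)
  else True.

(* [dW] and [dV] are the (unique) Borel measures induced by [W] and [V]. *)
Definition stieltjes_oc (R : realType) (W : R -> R)
    (dW : {measure set (measurableTypeR R) -> \bar R}) : Prop :=
  forall a b : R, a <= b -> dW `]a, b]%classic = (W b - W a)%:E.

Definition stieltjes_co (R : realType) (V : R -> R)
    (dV : {measure set (measurableTypeR R) -> \bar R}) : Prop :=
  forall a b : R, a <= b -> dV `[a, b[%classic = (V b - V a)%:E.

Definition mean_zero (R : realType)
    (mu : {measure set (measurableTypeR R) -> \bar R}) (f : R -> R) : Prop :=
  (\int[mu]_(x in `[0%R, 1%R[) (f x)%:E = 0)%E.

Definition CinfWV0 (R : realType) (W V : R -> R)
    (dW dV : {measure set (measurableTypeR R) -> \bar R}) (f : R -> R) : Prop :=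
  [/\ forall x, f (x + 1) = f x,
      cadlag f,
      mean_zero dV f &
      forall n, (0 < n)%N ->
        derivableWV W V n f /\
        if odd n then caglad (derivWV W V n f) /\ mean_zero dW (derivWV W V n f)
        else cadlag (derivWV W V n f) /\ mean_zero dV (derivWV W V n f)].

Definition CinfWV (R : realType) (W V : R -> R)
    (dW dV : {measure set (measurableTypeR R) -> \bar R}) (f : R -> R) : Prop :=
  exists (a : R) (g : R -> R), CinfWV0 W V dW dV g /\ f = (fun x => a + g x).

(* The polynomials are indexed from 1; the value 0 at index 0 is a dummy. *)
Fixpoint Fpoly (R : realType) (W : R -> R)
    (dW dV : {measure set (measurableTypeR R) -> \bar R}) (n : nat) (x s : R) : R :=
  if n is m.+1 then
    if m == 0%N then W s
    else if odd n then
      \int[dW]_(xi in `]0, s]) (Fpoly W dW dV m x x - Fpoly W dW dV m x xi)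
    else
      \int[dV]_(xi in `[0, s[) (Fpoly W dW dV m x x - Fpoly W dW dV m x xi)
  else 0.

Fixpoint Gpoly (R : realType) (V : R -> R)
    (dW dV : {measure set (measurableTypeR R) -> \bar R}) (n : nat) (x s : R) : R :=
  if n is m.+1 then
    if m == 0%N then V s
    else if odd n then
      \int[dV]_(xi in `[0, s[) (Gpoly V dW dV m x x - Gpoly V dW dV m x xi)
    else
      \int[dW]_(xi in `]0, s]) (Gpoly V dW dV m x x - Gpoly V dW dV m x xi)
  else 0.

Definition supnorm (R : realType) (g : R -> R) : \bar R :=
  ereal_sup [set `|g x|%:E | x in `[0, 1[].

(* Main.v *)
Require Import Defs.
From mathcomp Require Import all_boot all_order all_algebra.
From mathcomp Require Import all_classical all_reals all_analysis.
From mathcomp Require Import measurable_realfun.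
From mathcomp Require Import zify ring lra.
Import Order.TTheory GRing.Theory Num.Theory.
Import numFieldNormedType.Exports.
Local Open Scope classical_set_scope.
Local Open Scope ring_scope.

(* Fix x and write Phi_k(s) = F_k(x, x) - F_k(x, s), Phi_0 = 1.  On a short
   interval [a, b] a function with W-derivative g has increment about
   g(b) (W(b) - W(a)) and one with V-derivative h about h(a) (V(b) - V(a)), so
   in the sum over k <= n of D^(k) f * Phi_k the increments telescope to
   D^(n+1) f * Phi_n times one increment of W or V.  A compactness argument on
   [0, x] turns this into Taylor's formula with remainder at most
   sup |D^(n+1) f| * F_(n+1)(x, x).  The same argument bounds F_2n(x, x) by
   (W(1) V(1))^n / n!^2: the iterated integrals run over strictly ordered
   points, so atoms of dW and dV do not spoil the factorials.  The conditions
   on the torus are the expansions of D^(j) f at x = 1 = 0. *)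

Set Implicit Arguments.
Unset Strict Implicit.
Unset Printing Implicit Defensive.

(** * Local analysis on a compact interval *)

Section Finely.
Context {R : realType}.
Implicit Types (a b s x y lo hi d e : R) (t : bool) (Q : R -> R -> Prop).

(* [Q a b] holds on all short enough intervals having [s] as an endpoint, how
   short depending on [s]; requiring [s] to be an endpoint is what makes this
   compatible with one-sided limits. *)
Definition finely lo hi Q := forall s, lo <= s <= hi ->
  \forall d \near 0^'+, forall a b, lo <= a -> a <= b -> b <= hi ->
    s = a \/ s = b -> b - a < d -> Q a b.

Lemma finely_imp2 lo hi Q1 Q2 Q3 :
  (forall a b, lo <= a -> a <= b -> b <= hi -> Q1 a b -> Q2 a b -> Q3 a b) ->
  finely lo hi Q1 -> finely lo hi Q2 -> finely lo hi Q3.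
Proof.
move=> Q123 F1 F2 s sI; have := F2 s sI; have := F1 s sI; apply: filterS2.
by move=> d d1 d2 a b la ab bh sE bad; apply: Q123 => //; [exact: d1|exact: d2].
Qed.

Lemma finely_imp lo hi Q1 Q2 :
  (forall a b, lo <= a -> a <= b -> b <= hi -> Q1 a b -> Q2 a b) ->
  finely lo hi Q1 -> finely lo hi Q2.
Proof. by move=> Q12 F1; apply: (finely_imp2 _ F1 F1) => a b la ab bh q _; exact: Q12. Qed.

Lemma finely_all lo hi Q :
  (forall a b, lo <= a -> a <= b -> b <= hi -> Q a b) -> finely lo hi Q.
Proof. by move=> Qab s sI; near=> d => a b *; exact: Qab.
Unshelve. all: by end_near. Qed.

(* Cousin's lemma. *)
Lemma finely_additive lo hi Q : lo <= hi ->
  (forall a b c, lo <= a -> a <= b -> b <= c -> c <= hi ->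
     Q a b -> Q b c -> Q a c) ->
  finely lo hi Q -> Q lo hi.
Proof.
move=> lohi Qadd F.
have Qpos s : lo <= s <= hi -> exists2 d, 0 < d & forall a b, lo <= a ->
    a <= b -> b <= hi -> s = a \/ s = b -> b - a < d -> Q a b.
  move=> /F Fs; near (0:R)^'+ => d; exists d; first by near: d; exact: nbhs_right_gt.
  by near: d.
pose S := [set t : R | lo <= t <= hi /\ Q lo t].
have Slo : S lo.
  split; first by rewrite lexx.
  have [|d d0] := Qpos lo; first by rewrite lexx.
  by apply => //; [left | rewrite subrr].
have Subs : ubound S hi by move=> t [/andP[]].
have hsS : has_sup S by split; [exists lo | exists hi].
have losup : lo <= sup S by apply: ub_le_sup => //; exists hi.
have suphi : sup S <= hi by apply: ge_sup => //; exists lo.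
have [|d d0 Qd] := Qpos (sup S); first by rewrite losup.
(* Points of [S] approach the supremum, and an interval ending at [sup S] is governed by the [d] of
   [sup S], so the supremum is attained. If it were below [hi], the same [d] would allow a step of
   up to d/2 beyond it. *)
have Qs : Q lo (sup S).
  have [t [/andP[lot thi] Qt] st] := sup_adherent d0 hsS.
  have ts : t <= sup S by apply: ub_le_sup => //; [exists hi | split=> //; rewrite lot].
  apply: (Qadd lo t) => //; apply: Qd => //; first by right.
  by rewrite ltrBlDr -ltrBlDl.
have [->//|shi] := eqVneq hi (sup S).
have {}shi : sup S < hi by rewrite lt_neqAle eq_sym shi.
pose t := Num.min hi (sup S + d / 2).
have st : sup S < t by rewrite lt_min shi ltrDl divr_gt0.
have thi : t <= hi by rewrite ge_min lexx.
have : t <= sup S.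
  apply: ub_le_sup; first by exists hi.
  split; first by rewrite thi (le_trans losup)// ltW.
  apply: (Qadd lo (sup S)) => //; first exact: ltW.
  apply: Qd => //; [exact: ltW|by left|].
  have : t <= sup S + d / 2 by rewrite ge_min lexx orbT.
  lra.
by rewrite leNgt st.
Unshelve. all: by end_near. Qed.

Lemma near_left_ball s (P : R -> Prop) : (\forall y \near s^'-, P y) ->
  \forall d \near 0^'+, forall y, s - d < y -> y < s -> P y.
Proof.
move=> /nbhs_ballP[e /= e0 eP]; near=> d => y sdy ys; apply: eP => //.
rewrite /ball/= gtr0_norm ?subr_gt0// ltrBlDr -ltrBlDl (le_lt_trans _ sdy)//.
by rewrite lerB//; near: d; exact: nbhs_right_le.
Unshelve. all: by end_near. Qed.

Lemma near_right_ball s (P : R -> Prop) : (\forall y \near s^'+, P y) ->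
  \forall d \near 0^'+, forall y, s < y -> y < s + d -> P y.
Proof.
move=> /nbhs_ballP[e /= e0 eP]; near=> d => y sy ysd; apply: eP => //.
rewrite /ball/= distrC gtr0_norm ?subr_gt0// ltrBlDr addrC (lt_le_trans ysd)//.
by rewrite lerD//; near: d; exact: nbhs_right_le.
Unshelve. all: by end_near. Qed.

(* The flag is [true] for the integrator [W], whose measure is given on
   intervals ]a, b], and [false] for [V], given on intervals [a, b[. *)
Definition halfopen (t : bool) a b := Interval (BSide (~~ t) a) (BSide (~~ t) b).

Definition closed_end (t : bool) a b := if t then b else a.

(** The regularity of a derivative taken with respect to the integrator of kind [t]. That
    integrator, and whatever is differentiated against it, has the opposite regularity
    [regulated (~~ t)]. *)
Definition regulated (t : bool) (g : R -> R) := if t then caglad g else cadlag g.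

Definition small_osc (t : bool) lo hi (g : R -> R) := forall e, 0 < e ->
  finely lo hi (fun a b => forall x, x \in halfopen t a b ->
    `|g x - g (closed_end t a b)| <= e).

(** If [s] is the closed end, one-sided continuity at [s] applies directly. If [s] is the open end,
    only a one-sided limit exists there; both values are compared with it, at a cost of e/2 each. *)
Lemma regulated_small_osc t lo hi g : regulated t g -> small_osc t lo hi g.
Proof.
case: t => /= [|] rg e e0 s sI; have [gs /cvg_ex[/= l gl]] := rg s;
  have e20 : 0 < e / 2 by rewrite divr_gt0.
- have /near_left_ball : \forall y \near s^'-, `|g s - g y| < e.
    by move/cvgrPdist_lt: gs; apply.
  have /near_right_ball : \forall y \near s^'+, `|l - g y| < e / 2.
    by move/cvgrPdist_lt: gl; apply.
  apply: filterS2 => d Hr Hl a b la ab bh sE bad x.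
  rewrite /halfopen/= in_itv/= => /andP[ax xb]; case: sE => sE; subst s.
    have H y : a < y -> y <= b -> `|l - g y| < e / 2.
      by move=> ay yb; apply: Hr => //; lra.
    have := H x ax xb; have := H b (lt_le_trans ax xb) (lexx _).
    by rewrite !ltr_norml ler_norml; lra.
  have [->|xb'] := eqVneq x b; first by rewrite subrr normr0 ltW.
  by rewrite distrC ltW// Hl ?lt_neqAle ?xb'//; lra.
- have /near_right_ball : \forall y \near s^'+, `|g s - g y| < e.
    by move/cvgrPdist_lt: gs; apply.
  have /near_left_ball : \forall y \near s^'-, `|l - g y| < e / 2.
    by move/cvgrPdist_lt: gl; apply.
  apply: filterS2 => d Hl Hr a b la ab bh sE bad x.
  rewrite /halfopen/= in_itv/= => /andP[ax xb]; case: sE => sE; subst s; last first.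
    have H y : a <= y -> y < b -> `|l - g y| < e / 2.
      by move=> ay yb; apply: Hl => //; lra.
    have := H x ax xb; have := H a (lexx _) (le_lt_trans ax xb).
    by rewrite !ltr_norml ler_norml; lra.
  have [->|xa'] := eqVneq x a; first by rewrite subrr normr0 ltW.
  by rewrite distrC ltW// Hr ?lt_neqAle ?[a == x]eq_sym ?xa'//; lra.
Qed.

Lemma small_oscN t lo hi (g : R -> R) :
  small_osc t lo hi g -> small_osc t lo hi (fun x => - g x).
Proof.
move=> osc e e0; apply: finely_imp (osc e e0) => a b _ _ _ H x /H.
by rewrite -opprD normrN.
Qed.

(** Continuation leftwards from [b]: right continuity gives H <= H b at the infimum of [S], and the
    left-hand inequality there extends the set further down unless the infimum is already [a]. *)
Lemma left_monotone (H : R -> R) a b : a <= b ->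
  (forall x, a < x <= b -> \forall y \near x^'-, H y <= H x) ->
  (forall x, a <= x < b -> H y @[y --> x^'+] --> H x) ->
  H a <= H b.
Proof.
move=> ab Hl Hr.
pose S := [set t : R | a <= t <= b /\ forall y, t <= y <= b -> H y <= H b].
have Sb : S b.
  by split; [rewrite ab lexx|move=> y yb; rewrite (_ : y = b)//; apply/eqP; rewrite eq_le andbC].
have hiS : has_inf S by split; [exists b|exists a => t [/andP[]]].
have alb : lbound S a by move=> t [/andP[]].
have ainf : a <= inf S by apply: lb_le_inf => //; exists b.
have infb : inf S <= b by apply: ge_inf => //; exists a.
have Hgt y : inf S < y -> y <= b -> H y <= H b.
  move=> sy yb; have [t [/andP[tge tb] Ht] ty] := inf_lt hiS.1 sy.
  by apply: Ht; rewrite (ltW ty).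
have Hinf : H (inf S) <= H b.
  have [->//|sb] := eqVneq (inf S) b.
  have {}sb : inf S < b by rewrite lt_neqAle sb.
  have := Hr (inf S); rewrite ainf sb => /(_ isT) Hs.
  apply: (cvgr_to_le Hs) => //.
  near=> y; apply: Hgt; [near: y; exact: nbhs_right_gt|near: y; exact: nbhs_right_le].
have [->//|] := eqVneq a (inf S).
move=> ais; have {}ais : a < inf S by rewrite lt_neqAle ais.
have := Hl (inf S); rewrite ais infb => /(_ isT) /near_left_ball Hd.
have [d d0 {}Hd] : exists2 d, 0 < d & forall y, inf S - d < y -> y < inf S -> H y <= H (inf S).
  near (0:R)^'+ => d; exists d; first by near: d; exact: nbhs_right_gt.
  by near: d.
pose t := Num.max a (inf S - d / 2).
have tge : a <= t by rewrite le_max lexx.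
have tS : t < inf S by rewrite gt_max ais ltrBlDr ltrDl divr_gt0.
have : inf S <= t.
  apply: ge_inf; first by exists a.
  split=> [|y /andP[ty yb]]; first by rewrite tge (le_trans _ infb)// ltW.
  have [sy|ys] := ltP (inf S) y; first exact: Hgt.
  have [->//|yS] := eqVneq y (inf S).
  apply: le_trans Hinf; apply: Hd; last by rewrite lt_neqAle yS.
  have : inf S - d / 2 <= t by rewrite le_max lexx orbT.
  lra.
by rewrite leNgt tS.
Unshelve. all: by end_near. Qed.

Lemma right_monotone (H : R -> R) a b : a <= b ->
  (forall x, a <= x < b -> \forall y \near x^'+, H x <= H y) ->
  (forall x, a < x <= b -> H y @[y --> x^'-] --> H x) ->
  H a <= H b.
Proof.
move=> ab Hr Hl; rewrite -lerN2 -{1}(opprK b) -{1}(opprK a).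
(* Reflecting both argument and value exchanges left and right but preserves monotonicity. *)
pose K x := - H (- x); apply: (@left_monotone K); first by rewrite lerN2.
  move=> x xI; have := Hr (- x); rewrite lerNr ltrNl andbC xI => /(_ isT).
  have -> : x^'- = -%R @ (- x)^'+ by rewrite -at_leftN opprK.
  by apply: filterS => y Hxy; rewrite /= /K lerN2 opprK.
move=> x xI; have := Hl (- x); rewrite ltrNr lerNl andbC xI => /(_ isT).
rewrite at_leftN => Hx; rewrite /K; apply: cvgN.
exact: Hx.
Qed.
End Finely.

(** * Mean value inequalities for one-sided derivatives *)

Section MeanValue.
Context {R : realType}.
Implicit Types (a b x y e m M : R) (t : bool) (f U : R -> R).

(** Removes an error proportional to the increment [z] of an integrator. The division is by z + 1
    because [z] may vanish. *)
Lemma ler_forall_addM x y z : 0 <= z -> (forall e, 0 < e -> x <= y + e * z) ->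
  x <= y.
Proof.
move=> z0 H; apply/ler_addgt0Pr => e e0.
have z1 : 0 < z + 1 by lra.
apply: le_trans (H (e / (z + 1)) _) _; first by rewrite divr_gt0.
by rewrite lerD2l mulrAC ler_pdivrMr// ler_wpM2l ?ltW//; lra.
Qed.

Lemma near_left_shift x (P : R -> Prop) :
  (\forall h \near 0^'-, P h) -> \forall y \near x^'-, P (y - x).
Proof.
move=> /nbhs_left0P H; apply/nbhs_left0P; apply: filterS H => e.
by rewrite sub0r addrAC subrr sub0r.
Qed.

Lemma near_right_shift x (P : R -> Prop) :
  (\forall h \near 0^'+, P h) -> \forall y \near x^'+, P (y - x).
Proof.
move=> /nbhs_right0P H; apply/nbhs_right0P; apply: filterS H => e.
by rewrite add0r addrAC subrr add0r.
Qed.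

Definition one_sided_derivable t U f :=
  if t then left_derivable U f else right_derivable U f.

Definition one_sided_derivative t U f :=
  if t then left_derivative U f else right_derivative U f.

(** Apply the monotonicity lemmas to (M + e) U - f. The slack [e] makes the bound on the limit
    strict, hence valid for nearby quotients, on the side of differentiation; on the other side [U]
    and [f] are both continuous. *)
Lemma one_sided_derivative_ub t U f a b M :
  (forall x y, x < y -> U x < U y) -> regulated (~~ t) U ->
  regulated (~~ t) f -> one_sided_derivable t U f -> a <= b ->
  (forall x, x \in halfopen t a b -> one_sided_derivative t U f x <= M) ->
  f b - f a <= M * (U b - U a).
Proof.
move=> Uincr Ureg freg fder ab gM.
have U0 : 0 <= U b - U a.
  by rewrite subr_ge0; move: ab; rewrite le_eqVlt => /predU1P[->//|/Uincr/ltW].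
apply: (ler_forall_addM U0) => e e0.
pose H x := (M + e) * U x - f x.
suff : H a <= H b by rewrite /H; lra.
case: t Ureg freg fder gM => /= Ureg freg fder gM.
- apply: left_monotone => // x xI.
    have := fder x; rewrite /left_derivative in gM.
    move=> /cvgr_lt /(_ (M + e)) /=.
    have -> : lim (quotient_wrt U f x h @[h --> 0^'-]) < M + e.
      by rewrite (le_lt_trans (gM _ _)) ?ltrDl// /halfopen in_itv/=.
    move=> /(_ isT) /(near_left_shift x).
    have := nbhs_left_lt x; apply: filterS2 => y yx.
    rewrite /quotient_wrt (addrC x) subrK ltr_ndivrMr ?subr_lt0 ?Uincr// /H; lra.
  by apply: cvgB; [apply: cvgMr; have [] := Ureg x|have [] := freg x].
- apply: right_monotone => // x xI.
    have := fder x; rewrite /right_derivative in gM.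
    move=> /cvgr_lt /(_ (M + e)) /=.
    have -> : lim (quotient_wrt U f x h @[h --> 0^'+]) < M + e.
      by rewrite (le_lt_trans (gM _ _)) ?ltrDl// /halfopen in_itv/=.
    move=> /(_ isT) /(near_right_shift x).
    have := nbhs_right_gt x; apply: filterS2 => y yx.
    rewrite /quotient_wrt (addrC x) subrK ltr_pdivrMr ?subr_gt0 ?Uincr// /H; lra.
  by apply: cvgB; [apply: cvgMr; have [] := Ureg x|have [] := freg x].
Qed.

Lemma regulatedN t f : regulated t f -> regulated t (fun x => - f x).
Proof.
by case: t => fr x; have [fx fc] := fr x; split; [exact: cvgN|exact: is_cvgN|
  exact: cvgN|exact: is_cvgN].
Qed.

Lemma quotient_wrtN U f x h :
  quotient_wrt U (fun x => - f x) x h = - quotient_wrt U f x h.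
Proof. by rewrite /quotient_wrt; ring. Qed.

Lemma one_sided_derivableN t U f : one_sided_derivable t U f ->
  one_sided_derivable t U (fun x => - f x).
Proof.
by case: t => df x; under eq_fun do rewrite quotient_wrtN; exact: is_cvgN.
Qed.

Lemma one_sided_derivativeN t U f x : one_sided_derivable t U f ->
  one_sided_derivative t U (fun x => - f x) x = - one_sided_derivative t U f x.
Proof.
by case: t => df; rewrite /= /left_derivative /right_derivative;
  under eq_fun do rewrite quotient_wrtN; exact: limN.
Qed.

Lemma one_sided_derivative_lb t U f a b m :
  (forall x y, x < y -> U x < U y) -> regulated (~~ t) U ->
  regulated (~~ t) f -> one_sided_derivable t U f -> a <= b ->
  (forall x, x \in halfopen t a b -> m <= one_sided_derivative t U f x) ->
  m * (U b - U a) <= f b - f a.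
Proof.
move=> Uincr Ureg freg fder ab mg.
have := @one_sided_derivative_ub t U (fun x => - f x) a b (- m) Uincr Ureg
  (regulatedN freg) (one_sided_derivableN fder) ab.
suff H x : x \in halfopen t a b -> one_sided_derivative t U (fun x => - f x) x <= - m.
  by move=> /(_ H); lra.
by move=> /mg; rewrite one_sided_derivativeN// lerN2.
Qed.
End MeanValue.

(** * First-order expansions and the product rule *)

Section FirstOrder.
Context {R : realType} (U : bool -> R -> R).
Hypothesis U_nd : forall t a b, a <= b -> U t a <= U t b.
Implicit Types (a b x y e m M lo hi : R) (t : bool) (F g D P : R -> R).

(** An integral-free form of dF = g dU, which one-sided derivatives and Stieltjes integrals both
    satisfy; [first_order] is its infinitesimal version. *)
Definition mean_value t lo hi F g := forall a b m M,
  lo <= a -> a <= b -> b <= hi ->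
  (forall x, x \in halfopen t a b -> m <= g x <= M) ->
  m * (U t b - U t a) <= F b - F a <= M * (U t b - U t a).

Definition first_order t lo hi F g := forall e, 0 < e ->
  finely lo hi (fun a b =>
    `|F b - F a - g (closed_end t a b) * (U t b - U t a)| <=
    e * (U t b - U t a)).

Lemma mean_value_first_order t lo hi F g :
  mean_value t lo hi F g -> small_osc t lo hi g -> first_order t lo hi F g.
Proof.
move=> mv osc e e0; apply: finely_imp (osc e e0) => a b la ab bh H.
set q := closed_end t a b in H *.
have /andP[] : (g q - e) * (U t b - U t a) <= F b - F a <= (g q + e) * (U t b - U t a).
  by apply: mv => // x /H; rewrite ler_norml; lra.
by rewrite ler_norml; lra.
Qed.

(** The bound on [g] makes [F] Lipschitz with respect to [U t], so the oscillation of [F] is at most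
    [C] times that of [U t]. *)
Lemma mean_value_small_osc t lo hi F g C : 0 <= C ->
  (forall x, lo <= x <= hi -> `|g x| <= C) -> mean_value t lo hi F g ->
  regulated (~~ t) (U t) -> small_osc (~~ t) lo hi F.
Proof.
move=> C0 gC mv /(@regulated_small_osc _ _ lo hi) osc e e0.
have C1 : 0 < C + 1 by lra.
have Lip a b : lo <= a -> a <= b -> b <= hi -> `|F b - F a| <= C * (U t b - U t a).
  move=> la ab bh.
  have /andP[] : - C * (U t b - U t a) <= F b - F a <= C * (U t b - U t a).
    apply: mv => // x; have := gC x; rewrite ler_norml => H xab; apply: H.
    by case: t xab {osc}; rewrite /halfopen/= in_itv/=; lra.
  by rewrite ler_norml; lra.
have e1 : 0 < e / (C + 1) by rewrite divr_gt0.
apply: finely_imp (osc _ e1) => a b la ab bh H x xab.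
have {H} := H x xab.
have eE : e = (C + 1) * (e / (C + 1)) by rewrite mulrC divfK// gt_eqF.
move: xab; rewrite /halfopen.
case: t mv osc Lip => /= mv osc Lip; rewrite in_itv/= => /andP[ax xb] H.
  have := Lip a x la ax (le_trans (ltW xb) bh); move: H.
  move: (e / _) e1 eE => d d0 ->; rewrite !ler_norml.
  have := U_nd true ax.
  nra.
have := Lip x b (le_trans la (ltW ax)) xb bh; move: H.
move: (e / _) e1 eE => d d0 ->; rewrite !ler_norml.
have := U_nd false xb.
nra.
Qed.

(** The two closed ends are opposite endpoints, so the increment of D P splits exactly into one
    factor at an endpoint times the increment of the other. No product of increments is left over,
    even where both integrators jump. *)
Lemma first_order_mul t lo hi D D' P P' C :
  (forall x, lo <= x <= hi -> `|D x| <= C) ->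
  (forall x, lo <= x <= hi -> `|P x| <= C) ->
  first_order (~~ t) lo hi D D' -> first_order t lo hi P P' ->
  forall e, 0 < e -> finely lo hi (fun a b =>
    `|D b * P b - D a * P a
      - D' (closed_end (~~ t) a b) * P (closed_end (~~ t) a b)
        * (U (~~ t) b - U (~~ t) a)
      - D (closed_end t a b) * P' (closed_end t a b) * (U t b - U t a)|
    <= e * (U t b - U t a + (U (~~ t) b - U (~~ t) a))).
Proof.
move=> DC PC DD PP e e0.
have [hilo|lohi] := ltP hi lo.
  by apply: finely_all => a b la ab bh; exfalso; lra.
have C0 : 0 <= C by rewrite (le_trans _ (DC lo _))// lexx.
have C1 : 0 < C + 1 by lra.
have e1 : 0 < e / (C + 1) by rewrite divr_gt0.
have eE : e = (C + 1) * (e / (C + 1)) by rewrite mulrC divfK// gt_eqF.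
apply: finely_imp2 (DD _ e1) (PP _ e1) => a b la ab bh.
have Ut := U_nd t ab; have Unt := U_nd (~~ t) ab.
set dU := U t b - U t a; set dV := U (~~ t) b - U (~~ t) a.
have dU0 : 0 <= dU by rewrite subr_ge0.
have dV0 : 0 <= dV by rewrite subr_ge0.
set p := closed_end (~~ t) a b; set q := closed_end t a b => HD HP.
have pI : lo <= p <= hi by rewrite /p; case: (t); rewrite /= ?la ?bh ?(le_trans la)// (le_trans ab).
have qI : lo <= q <= hi by rewrite /q; case: (t); rewrite /= ?la ?bh ?(le_trans la)// (le_trans ab).
have -> : D b * P b - D a * P a - D' p * P p * dV - D q * P' q * dU =
    (D b - D a - D' p * dV) * P p + D q * (P b - P a - P' q * dU).
  by rewrite /p /q; case: (t) => /=; ring.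
rewrite (le_trans (ler_normD _ _))// !normrM.
apply: (@le_trans _ _ (e / (C + 1) * dV * C + C * (e / (C + 1) * dU))).
  by rewrite lerD// ler_pM// ?DC ?PC.
move: (e / _) e1 eE => d d0 ->; nra.
Qed.
End FirstOrder.

(** * Taylor's formula with remainder *)

(** Replaces the derivative of a power across a jump: with the power taken at the smaller value [y],
    atoms do not destroy the factor n + 1. *)
Lemma exprS_sub_ge {R : realType} (x y : R) n : 0 <= y -> y <= x ->
  y ^+ n * (x - y) * n.+1%:R <= x ^+ n.+1 - y ^+ n.+1.
Proof.
move=> y0 yx; elim: n => [|n IHn]; first by rewrite !expr0 !expr1 mul1r mulr1.
have yn : 0 <= y ^+ n * (x - y) * n.+1%:R.
  by rewrite mulr_ge0// mulr_ge0 ?exprn_ge0 ?subr_ge0.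
have := ler_pM y0 yn yx IHn.
have -> : n.+2%:R = n.+1%:R + 1 :> R by rewrite natr1.
by rewrite (exprS x n.+1) (exprS y n.+1) (exprS y n); lra.
Qed.

Section Taylor.
Context {R : realType} (U : bool -> R -> R).
Hypothesis U_nd : forall t a b, a <= b -> U t a <= U t b.
Variables (p : bool) (lo hi : R) (Phi : nat -> R -> R).

(* With [p = true] the kind of integrator alternates W, V, W, ... as in the
   [F_k]; with [p = false] it alternates V, W, V, ... as in the [G_k]. *)
Definition side (k : nat) := p (+) odd k.

Hypothesis Phi0 : forall x, Phi 0 x = 1.
Hypothesis Phi_ge0 : forall k x, lo <= x <= hi -> 0 <= Phi k x.
Hypothesis Phi_fo : forall k,
  first_order U (side k) lo hi (Phi k.+1) (fun x => - Phi k x).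

Lemma sideS k : side k.+1 = ~~ side k.
Proof. by rewrite /side /= addbN. Qed.

Lemma incr_side t a b :
  U t b - U t a + (U (~~ t) b - U (~~ t) a) =
  U true b - U true a + (U false b - U false a).
Proof. by case: t => //=; rewrite addrC. Qed.

Let incr_ge0 t a b : a <= b -> 0 <= U t b - U t a.
Proof. by move=> ab; rewrite subr_ge0 U_nd. Qed.

Lemma closed_end_itv t a b :
  lo <= a -> a <= b -> b <= hi -> lo <= closed_end t a b <= hi.
Proof. by case: t => /= la ab bh; rewrite ?la ?bh ?(le_trans la)// (le_trans ab). Qed.

Section Remainder.
Variable d : nat -> R -> R.
Hypothesis d_fo : forall k, first_order U (side k) lo hi (d k) (d k.+1).
Hypothesis bounded : forall k, exists C, forall x, lo <= x <= hi ->
  `|d k x| <= C /\ `|Phi k x| <= C.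

(* The increments of consecutive products [d k * Phi k] cancel to first order. *)
Lemma taylor_sum_first_order n e : 0 < e -> finely lo hi (fun a b =>
  `|\sum_(k < n.+1) d k b * Phi k b - \sum_(k < n.+1) d k a * Phi k a
    - d n.+1 (closed_end (side n) a b) * Phi n (closed_end (side n) a b)
      * (U (side n) b - U (side n) a)| <=
  e * (U true b - U true a + (U false b - U false a))).
Proof.
elim: n e => [|n IHn] e e0.
  apply: finely_imp (d_fo 0 e0) => a b la ab bh.
  rewrite !big_ord1 !Phi0 !mulr1 => H; apply: le_trans H _.
  have := incr_ge0 true ab; have := incr_ge0 false ab.
  by case: (side 0); nra.
have e2 : 0 < e / 2 by rewrite divr_gt0.
have [C dC] := bounded n.+1.
have fo := d_fo n.+1; rewrite sideS in fo.
have := @first_order_mul _ U U_nd (side n) lo hi _ _ _ _ C _ _ fo (Phi_fo n) _ e2.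
move=> /(_ (fun x xI => (dC x xI).1) (fun x xI => (dC x xI).2)).
apply: finely_imp2 (IHn _ e2) => a b la ab bh.
rewrite incr_side !(big_ord_recr n.+1)/= !sideS.
set S1 := \sum_(i < _) _; set S2 := \sum_(i < _) _.
set q := closed_end (~~ _) _ _; set r := closed_end _ _ _.
set A := U true b - _ + _.
move=> H1 H2.
(* The term in [d n.+1 r] left over by the first [n] products cancels the one from the product rule,
   because the density of [Phi n.+1] is [- Phi n]. *)
have -> : S1 + d n.+1 b * Phi n.+1 b - (S2 + d n.+1 a * Phi n.+1 a) -
   d n.+2 q * Phi n.+1 q * (U (~~ side n) b - U (~~ side n) a) =
   (S1 - S2 - d n.+1 r * Phi n r * (U (side n) b - U (side n) a)) +
   (d n.+1 b * Phi n.+1 b - d n.+1 a * Phi n.+1 a -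
     d n.+2 q * Phi n.+1 q * (U (~~ side n) b - U (~~ side n) a) -
     d n.+1 r * - Phi n r * (U (side n) b - U (side n) a)) by ring.
rewrite (le_trans (ler_normD _ _))//.
by rewrite (_ : e * A = e / 2 * A + e / 2 * A) ?lerD//; field.
Qed.

Lemma taylor_remainder n M : lo <= hi ->
  (forall x, lo <= x <= hi -> `|d n.+1 x| <= M) ->
  `|\sum_(k < n.+1) d k hi * Phi k hi - \sum_(k < n.+1) d k lo * Phi k lo| <=
  M * (Phi n.+1 lo - Phi n.+1 hi).
Proof.
move=> lohi dM.
have M0 : 0 <= M by rewrite (le_trans _ (dM lo _))// lexx.
pose A a b := U true b - U true a + (U false b - U false a).
have A0 a b : a <= b -> 0 <= A a b by move=> ab; rewrite addr_ge0 ?incr_ge0.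
apply: (ler_forall_addM (A0 _ _ lohi)) => e e0.
pose S x := \sum_(k < n.+1) d k x * Phi k x.
(* The right-hand side is additive over adjacent intervals, so Cousin's lemma reduces the claim to
   short ones. *)
apply: (finely_additive (Q := fun a b => `|S b - S a| <=
    M * (Phi n.+1 a - Phi n.+1 b) + e * A a b)) => //.
  move=> a b c la ab bc ch Hab Hbc.
  rewrite (_ : S c - S a = (S b - S a) + (S c - S b)); last ring.
  by rewrite (le_trans (ler_normD _ _))// (le_trans (lerD Hab Hbc))// /A; lra.
have e2 : 0 < e / 2 by rewrite divr_gt0.
have M1 : 0 < M + 1 by lra.
(* The error made in replacing [Phi n] times the increment by the drop of [Phi n.+1] gets multiplied
   by [M]. *)
have e1 : 0 < (e / 2) / (M + 1) by rewrite divr_gt0.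
have eE : e / 2 = (M + 1) * ((e / 2) / (M + 1)) by rewrite [RHS]mulrC divfK// gt_eqF.
apply: finely_imp2 (taylor_sum_first_order n e2) (Phi_fo n e1) => a b la ab bh.
rewrite -/(S a) -/(S b) -/(A a b).
set q := closed_end _ _ _; set dU := U (side n) b - _.
have dUA : dU <= A a b.
  have := incr_ge0 true ab; have := incr_ge0 false ab.
  by rewrite /dU /A; case: (side n); lra.
have dU0 : 0 <= dU by rewrite incr_ge0.
have qI := closed_end_itv (side n) la ab bh.
have := dM q qI; have P0 := Phi_ge0 n qI; rewrite -/q in P0.
move: (d n.+1 q) (Phi n q) P0 => D P P0.
move: (A a b) dUA (A0 _ _ ab) => B dUB B0.
move: (S b - S a) => X; move: (Phi n.+1 a) (Phi n.+1 b) => Pa Pb.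
move: e1 eE; set c := _ / (M + 1) => c0 eE.
have PU0 : 0 <= P * dU by rewrite mulr_ge0.
move=> DM H1 H2.
have DPU : `|D * P * dU| <= M * (P * dU) by rewrite -mulrA normrM (ger0_norm PU0) ler_wpM2r.
have PPU : P * dU <= Pa - Pb + c * dU by move: H2; rewrite ler_norml; lra.
have -> : X = (X - D * P * dU) + D * P * dU by ring.
rewrite (le_trans (ler_normD _ _))//.
apply: (le_trans (lerD H1 DPU)).
have H3 : M * (P * dU) <= M * (Pa - Pb + c * dU) by rewrite ler_wpM2l.
have H4 : (M + 1) * c * dU <= (M + 1) * c * B by rewrite ler_wpM2l// -eE ltW.
have H5 : 0 <= c * dU by rewrite mulr_ge0// ltW.
by rewrite -eE in H4; nra.
Qed.
End Remainder.

(** * Factorial bounds for iterated integrals *)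

Section Bound.
Hypothesis U_left : forall x, U false y @[y --> x^'-] --> U false x.
Hypothesis Phi_osc : forall k, small_osc (side k) lo hi (Phi k).
Hypothesis Phi_hi : forall k, Phi k.+1 hi = 0.

Definition steps t k := (\sum_(j < k) (side j == t))%N.

(** For a continuous [U t] this is the mass of the ordered tuples of [steps t k] points between [x]
    and [hi]. *)
Definition step_weight t k x :=
  (U t hi - U t x) ^+ steps t k / (steps t k)`!%:R.

Lemma step_weight_ge0 t k x : x <= hi -> 0 <= step_weight t k x.
Proof. by move=> xh; rewrite divr_ge0// exprn_ge0// incr_ge0. Qed.

Lemma step_weight_le t k x y : x <= y -> y <= hi ->
  step_weight t k y <= step_weight t k x.
Proof.
move=> xy yh; rewrite ler_pM2r ?invr_gt0 ?ltr0n ?fact_gt0//.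
by rewrite lerXn2r ?nnegrE ?incr_ge0 ?lerB ?U_nd// (le_trans xy).
Qed.

Lemma step_weightC t k x :
  step_weight t k x * step_weight (~~ t) k x =
  step_weight true k x * step_weight false k x.
Proof. by case: t => //=; rewrite mulrC. Qed.

(** A step of kind [side k] raises the exponent by one; this is [exprS_sub_ge] divided by (n +
    1)!. *)
Lemma step_weightS k a b : a <= b -> b <= hi ->
  step_weight (side k) k b * (U (side k) b - U (side k) a) <=
  step_weight (side k) k.+1 a - step_weight (side k) k.+1 b.
Proof.
move=> ab bh; rewrite /step_weight {3 4 5 6}/steps big_ord_recr/= eqxx addn1 -/(steps _ _).
move: (side k) => t; set n := steps _ _.
set x := U t hi - U t a; set y := U t hi - U t b.
have y0 : 0 <= y by rewrite incr_ge0.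
have yx : y <= x by rewrite lerB// U_nd.
have -> : U t b - U t a = x - y by rewrite /x /y; ring.
rewrite -mulrBl ler_pdivlMr ?ltr0n ?fact_gt0// factS natrM.
rewrite [leLHS](_ : _ = y ^+ n * (x - y) * n.+1%:R); first exact: exprS_sub_ge.
by field; rewrite pnatr_eq0 -lt0n fact_gt0.
Qed.

Lemma finely_sub x Q : lo <= x -> finely lo hi Q -> finely x hi Q.
Proof.
move=> lx F s /andP[xs sh]; have := F s; rewrite (le_trans lx xs) sh => /(_ isT).
by apply: filterS => e H a b xa; apply: H; rewrite (le_trans lx).
Qed.

(** By induction on [k]. On a short interval [Phi k.+1] drops by about [Phi k] at the closed end
    times an increment of [U], and the product [B] of the weights drops by at least the bound for
    this: one weight gains a factor and the other is nonincreasing. The drops add up to [hi], where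
    [Phi k.+1] vanishes. *)
Lemma Phi_ub k x : lo <= x <= hi ->
  Phi k x <= step_weight true k x * step_weight false k x.
Proof.
elim: k x => [|k IHk] x /andP[lx xh].
  by rewrite /step_weight /steps !big_ord0 Phi0 !expr0 fact0 !divr1 mulr1.
set t := side k.
pose B y := step_weight true k.+1 y * step_weight false k.+1 y.
(* For [V] the value [Phi k a] must be compared with the weight at [b], across
   a possible atom at [a]: move to points of [a, b[, where [Phi k] has small
   oscillation, and use the left continuity of [V] at [b]. *)
have local_ub e : 0 < e -> finely lo hi (fun a b =>
    Phi k (closed_end t a b) <= step_weight t k b * step_weight (~~ t) k a + e).
  move=> e0; apply: finely_imp (Phi_osc k e0) => a b la ab bh.
  have bI : lo <= b <= hi by rewrite bh (le_trans la).
  have aI : lo <= a <= hi by rewrite la (le_trans ab).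
  rewrite -/t; case: t => /= H.
    apply: (le_trans (IHk _ bI)); rewrite -[leLHS]addr0 lerD ?(ltW e0)//.
    by rewrite ler_wpM2l ?step_weight_ge0 ?step_weight_le.
  have [<-|ab'] := eqVneq a b.
    by apply: (le_trans (IHk _ aI)); rewrite mulrC lerDl ltW.
  have {}ab' : a < b by rewrite lt_neqAle ab'.
  pose g y := step_weight false k y * step_weight true k a + e.
  have gb : g y @[y --> b^'-] --> g b.
    apply: cvgD; last exact: cvg_cst.
    apply: cvgMl; apply: cvgMl.
    have Vb : U false hi - U false y @[y --> b^'-] --> U false hi - U false b.
      by apply: cvgB => //; exact: cvg_cst.
    exact: (continuous_cvg _ (@exprn_continuous R (steps false k) _) Vb).
  apply: (cvgr_to_ge gb); near=> y.
  have ay : a <= y by near: y; exact: nbhs_left_ge.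
  have yb : y < b by near: y; exact: nbhs_left_lt.
  have yI : lo <= y <= hi by rewrite (le_trans la ay) (le_trans (ltW yb)).
  have := H y; rewrite /halfopen in_itv/= ay yb => /(_ isT).
  rewrite ler_norml => Hy.
  have : step_weight true k y * step_weight false k y <=
      step_weight false k y * step_weight true k a.
    by rewrite mulrC ler_wpM2l ?step_weight_ge0 ?step_weight_le// (le_trans (ltW yb)).
  by have := IHk y yI; rewrite /g; lra.
have Bhi : 0 <= B hi by rewrite mulr_ge0 ?step_weight_ge0.
suff : Phi k.+1 x - Phi k.+1 hi <= B x - B hi by rewrite Phi_hi /B in Bhi *; lra.
apply: (ler_forall_addM (incr_ge0 t xh)) => e e0.
apply: (finely_additive (Q := fun a b => Phi k.+1 a - Phi k.+1 b <=
    B a - B b + e * (U t b - U t a))) => //.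
  by move=> a b c _ ab bc _; lra.
apply: finely_sub lx _.
have e2 : 0 < e / 2 by rewrite divr_gt0.
apply: finely_imp2 (local_ub _ e2) (Phi_fo k e2) => a b la ab bh H1.
rewrite -/t ler_norml => /andP[+ _].
have W1 := step_weightS k ab bh; rewrite -/t in W1.
have U0 := incr_ge0 t ab; have := ler_wpM2r U0 H1.
have ah : a <= hi by rewrite (le_trans ab).
rewrite /B -!(step_weightC t).
have WS y : step_weight (~~ t) k.+1 y = step_weight (~~ t) k y.
  by rewrite /step_weight /steps big_ord_recr/= -/t (_ : (t == ~~ t) = false) ?addn0//; case: (t).
rewrite !WS.
have W2 := ler_wpM2r (step_weight_ge0 (~~ t) k ah) W1.
have W3 := ler_wpM2l (step_weight_ge0 t k.+1 bh) (step_weight_le (~~ t) k ab bh).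
lra.
Unshelve. all: by end_near. Qed.

End Bound.

End Taylor.

(** * Generalized polynomials *)

Section StieltjesIntegral.
Context {R : realType} (U : R -> R) (t : bool).
Variable mu : {measure set (measurableTypeR R) -> \bar R}.
Hypothesis muE : forall a b : R, a <= b ->
  mu [set` halfopen t a b] = (U b - U a)%:E.
Implicit Types a b c y m M : R.
Variables (x : R) (g : R -> R).
Hypothesis g_ni : forall a b : R, 0 <= a -> a <= b -> b <= x -> g b <= g a.

Lemma halfopen_itv a b y : y \in halfopen t a b -> a <= y <= b.
Proof.
by case: t; rewrite /halfopen in_itv/= => /andP[ay yb]; rewrite ?(ltW ay) ?(ltW yb) ?ay ?yb.
Qed.

Lemma halfopen_integrable a b : 0 <= a -> a <= b -> b <= x ->
  mu.-integrable [set` halfopen t a b] (EFin \o g).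
Proof.
move=> a0 ab bx.
have mh : measurable [set` halfopen t a b] by exact: measurable_itv.
apply: measurable_bounded_integrable => //.
- by rewrite muE// ltry.
(* Clamping the argument to [0, x], the only range where [g] is known to be monotone, gives a
   globally monotone and hence measurable function. *)
- pose c y := Num.max 0 (Num.min y x).
  apply: (@eq_measurable_fun _ _ _ _ _ (g \o c)) => [y|].
    rewrite inE => /halfopen_itv/andP[ay yb] /=.
    by rewrite /c (min_idPl _) ?(max_idPr _) ?(le_trans yb) ?(le_trans a0).
  apply: nonincreasing_measurable => // y z yz /=.
  have x0 : 0 <= x by rewrite (le_trans a0)// (le_trans ab).
  apply: g_ni; rewrite /c.
  - by rewrite le_max lexx.
  - by rewrite le_max2// le_min2.
  - by rewrite ge_max x0 ge_min lexx orbT.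
- exists (`|g 0| + `|g x|); split; first exact: num_real.
  move=> M gM y /= /halfopen_itv/andP[ay yb]; apply: le_trans (ltW gM).
  have g1 : g y <= g 0 by apply: g_ni => //; [rewrite (le_trans a0)|rewrite (le_trans yb)].
  have g2 : g x <= g y by apply: g_ni => //; [rewrite (le_trans a0)|rewrite (le_trans yb)].
  rewrite ler_norml; have := ler_norm (g 0); have := ler_norm (- g x).
  by rewrite normrN; have := normr_ge0 (g 0); have := normr_ge0 (g x); lra.
Qed.

Lemma halfopen_setU a b c : a <= b -> b <= c ->
  [set` halfopen t a c] = [set` halfopen t a b] `|` [set` halfopen t b c].
Proof.
move=> ab bc; apply/seteqP; split=> y /=; rewrite /halfopen;
  case: t => /=; rewrite !in_itv/=.
- by move=> /andP[ay yc]; have [yb|yb] := leP y b; [left|right]; rewrite ?ay ?yb ?yc.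
- by move=> /andP[ay yc]; have [yb|yb] := ltP y b; [left|right]; rewrite ?ay ?yb ?yc.
- move=> [] /andP[H1 H2]; apply/andP; split=> //; first exact: le_trans bc.
  exact: le_lt_trans H1.
- move=> [] /andP[H1 H2]; apply/andP; split=> //; first exact: lt_le_trans bc.
  exact: le_trans H1.
Qed.

Lemma integral_mean_value a b m M : 0 <= a -> a <= b -> b <= x ->
  (forall y, y \in halfopen t a b -> m <= g y <= M) ->
  m * (U b - U a) <=
  \int[mu]_(y in [set` halfopen t 0 b]) g y -
  \int[mu]_(y in [set` halfopen t 0 a]) g y <= M * (U b - U a).
Proof.
move=> a0 ab bx gmM.
have mh c d : measurable ([set` halfopen t c d] : set (measurableTypeR R)) by exact: measurable_itv.
rewrite (halfopen_setU a0 ab) Rintegral_setU//; last 2 first.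
- by rewrite -halfopen_setU//; apply: halfopen_integrable => //; exact: le_trans ab.
- apply/disj_setPS => y [] /=; rewrite /halfopen; case: t; rewrite /= !in_itv/=; lra.
rewrite addrAC subrr add0r.
have icst c : mu.-integrable [set` halfopen t a b] (EFin \o cst c).
  apply: measurable_bounded_integrable => //; first by rewrite muE// ltry.
  exists `|c|; split; first exact: num_real.
  by move=> N cN y _ /=; rewrite ltW.
have ig := halfopen_integrable a0 ab bx.
have E c : \int[mu]_(y in [set` halfopen t a b]) c = c * (U b - U a).
  by rewrite Rintegral_cst// muE.
rewrite -!E; apply/andP; split.
  by apply: (le_Rintegral (mh a b) (icst m) ig) => y /= /gmM/andP[].
by apply: (le_Rintegral (mh a b) ig (icst M)) => y /= /gmM/andP[].
Qed.
End StieltjesIntegral.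

Section GeneralizedPolynomials.
Context {R : realType} (W V : R -> R).
Variables dW dV : {measure set (measurableTypeR R) -> \bar R}.
Hypothesis W_nd : forall a b, a <= b -> W a <= W b.
Hypothesis V_nd : forall a b, a <= b -> V a <= V b.
Hypothesis W0 : W 0 = 0.
Hypothesis V0 : V 0 = 0.
Hypothesis dWE : stieltjes_oc W dW.
Hypothesis dVE : stieltjes_co V dV.

Implicit Types a b s : R.

Definition integrator (t : bool) := if t then W else V.
Definition integrator_measure (t : bool) := if t then dW else dV.

Lemma integrator_measureE t a b : a <= b ->
  integrator_measure t [set` halfopen t a b] =
  (integrator t b - integrator t a)%:E.
Proof. by case: t; [exact: dWE|exact: dVE]. Qed.

Lemma integrator_nd t a b : a <= b -> integrator t a <= integrator t b.
Proof. by case: t; [exact: W_nd|exact: V_nd]. Qed.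

Definition gen_poly (p : bool) n x s :=
  if p then Fpoly W dW dV n x s else Gpoly V dW dV n x s.

(** The functions Phi_n. The value 1 at index 0 makes the first polynomial an integral of the tail
    of index 0, so all orders obey one recursion. *)
Definition gen_poly_tail p x n s :=
  if n is 0 then 1 else gen_poly p n x x - gen_poly p n x s.

Lemma gen_poly1 p x s : gen_poly p 1 x s = integrator p s.
Proof. by case: p. Qed.

Lemma gen_polySS p n x s : gen_poly p n.+2 x s =
  \int[integrator_measure (side p n.+1)]_(y in [set` halfopen (side p n.+1) 0 s])
    gen_poly_tail p x n.+1 y.
Proof.
by case: p; rewrite /side /=; case: (odd n).
Qed.

Lemma gen_polyS0 p n x : gen_poly p n.+1 x 0 = 0.
Proof.
case: n => [|n]; first by rewrite gen_poly1; case: p.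
rewrite gen_polySS (_ : [set` _] = set0) ?Rintegral_set0//.
by apply/seteqP; split=> y //=; rewrite /halfopen; case: side; rewrite in_itv/=; lra.
Qed.

(** The two claims need each other: the mean value property with a nonnegative density makes the
    next tail monotone, and monotonicity makes that tail integrable, which yields the next mean
    value property. *)
Lemma gen_poly_tail_mean_value p x n :
  (forall a b, 0 <= a -> a <= b -> b <= x ->
     0 <= gen_poly_tail p x n b <= gen_poly_tail p x n a) /\
  mean_value integrator (side p n) 0 x (gen_poly_tail p x n.+1)
    (fun s => - gen_poly_tail p x n s).
Proof.
elim: n => [|n [IHmono IHmv]].
  split=> [a b _ _ _ /=|a b m M a0 ab bx]; first by rewrite ler01 lexx.
  rewrite /side /= addbF !gen_poly1 => H.
  have [->|ab'] := eqVneq a b; first by rewrite !subrr !mulr0 lexx.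
  have /andP[m1 M1] : m <= -1 <= M.
    apply: (H (closed_end p a b)); rewrite /halfopen; case: (p) => /=;
      by rewrite in_itv/= lexx ?andbT lt_neqAle ab' ab.
  by have := integrator_nd p ab; nra.
have mono a b : 0 <= a -> a <= b -> b <= x ->
    0 <= gen_poly_tail p x n.+1 b <= gen_poly_tail p x n.+1 a.
  move=> a0 ab bx.
  have decr c d : 0 <= c -> c <= d -> d <= x ->
      gen_poly_tail p x n.+1 d <= gen_poly_tail p x n.+1 c.
    move=> c0 cd dx; rewrite -subr_le0.
    rewrite -[leRHS](mul0r (integrator (side p n) d - integrator (side p n) c)).
    have H y : y \in halfopen (side p n) c d ->
        - gen_poly_tail p x n c <= - gen_poly_tail p x n y <= 0.
      move=> /halfopen_itv/andP[cy yd].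
      have /andP[? ?] := IHmono c y c0 cy (le_trans yd dx).
      by rewrite lerN2 oppr_le0; apply/andP.
    by have /andP[] := IHmv c d _ _ c0 cd dx H.
  (* Nonnegativity follows from monotonicity because the tail vanishes at [x]. *)
  rewrite decr// andbT; apply: le_trans (decr b x _ bx _) => //; last exact: le_trans ab.
  by rewrite /= subrr.
split=> // a b m M a0 ab bx H.
have gni c d : 0 <= c -> c <= d -> d <= x ->
    gen_poly_tail p x n.+1 d <= gen_poly_tail p x n.+1 c.
  by move=> c0 cd dx; have /andP[] := mono c d c0 cd dx.
have H' y : y \in halfopen (side p n.+1) a b -> - M <= gen_poly_tail p x n.+1 y <= - m.
  by move=> /H /andP[? ?]; rewrite lerNl lerNr; apply/andP.
have := @integral_mean_value _ _ _ _ (@integrator_measureE (side p n.+1)) _ _ gni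
  a b (- M) (- m) a0 ab bx H'.
rewrite -!gen_polySS [gen_poly_tail p x n.+2 b]/= [gen_poly_tail p x n.+2 a]/=.
by move=> /andP[? ?]; apply/andP; split; lra.
Qed.
End GeneralizedPolynomials.

(** * Convergence of the expansion *)

Section Asymptotics.
Context {R : realType}.

Lemma bin_le_exp2 n m : ('C(n, m) <= 2 ^ n)%N.
Proof.
elim: n m => [|n IHn] [|m] //; first by rewrite bin0 expn_gt0.
by rewrite binS expnS mul2n -addnn leq_add.
Qed.

Lemma fact_addn_le m j : ((m + j)`! <= 2 ^ (m + j) * (m`! * j`!))%N.
Proof.
have := @bin_fact (m + j) m (leq_addr _ _); rewrite addKn => <-.
by rewrite leq_mul2r bin_le_exp2 orbT.
Qed.

Lemma cvg_half : n./2 @[n --> \oo] --> \oo.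
Proof.
move=> A [N _ NA]; exists N.*2 => // n /= Nn; apply: NA => /=.
by rewrite -(doubleK N) half_leq.
Qed.

(** With m = n./2, one of the two factorials in the denominator absorbs the growth of [c] up to 2^(m
    + j) j!. The other leaves a constant times (2 w^4)^m / m!, a coefficient of an exponential
    series. *)
Lemma factorial_growth_cvg0 (c : nat -> R) (w : R) j : 1 <= w ->
  c =o_\oo (fun n => n`!%:R / expR 1 ^+ n) ->
  c (n + j)./2 * (w ^+ n.*2 / ((n./2)`!%:R ^+ 2)) @[n --> \oo] --> 0.
Proof.
move=> w1 /eqoP/(_ 1 ltr01) [N _ cN].
have w0 : 0 <= w by rewrite (le_trans ler01).
pose K := 2 ^+ j * j`!%:R * w ^+ 2 : R.
have : K * exp_coeff (2 * w ^+ 4) n./2 @[n --> \oo] --> 0.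
  rewrite -[X in _ --> X](mulr0 K); apply: cvgMr.
  by apply: (cvg_comp _ _ cvg_half); exact: cvg_exp_coeff.
move=> bound; apply: norm_cvg0.
apply: (squeeze_cvgr _ (cvg_cst 0) bound).
near=> n; rewrite normr_ge0/=.
have nN : (N <= (n + j)./2)%N.
  have : (N.*2 <= n)%N by near: n; exists N.*2.
  by rewrite -{2}(doubleK N) => Nn; rewrite half_leq// (leq_trans Nn)// leq_addr.
set m := n./2.
have cm : `|c (n + j)./2| <= 2 ^+ (m + j) * (m`!%:R * j`!%:R).
  apply: (le_trans (cN _ nN)).
  rewrite mul1r normrM normfV normrX (gtr0_norm (expR_gt0 1)) normr_nat.
  apply: (@le_trans _ _ ((n + j)./2)`!%:R).
    rewrite ler_pdivrMr ?exprn_gt0 ?expR_gt0// ler_peMr// exprn_ege1//.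
    by rewrite -expR0 ler_expR.
  rewrite -!natrM -natrX -natrM ler_nat (leq_trans _ (fact_addn_le m j))//.
  by apply: leq_fact; rewrite /m; lia.
rewrite normrM (@ger0_norm _ (_ / _)) ?divr_ge0 ?exprn_ge0//.
have wn : w ^+ n.*2 <= w ^+ (4 * m + 2) by apply: ler_weXn2l => //; rewrite /m; lia.
apply: (@le_trans _ _ ((2 ^+ (m + j) * (m`!%:R * j`!%:R)) *
    (w ^+ (4 * m + 2) / m`!%:R ^+ 2))).
  rewrite ler_pM// ?divr_ge0 ?exprn_ge0// ler_wpM2r// invr_ge0 exprn_ge0//.
rewrite exp_coeffE /K (exprD w) (exprM w) (exprD 2) [(2 * w ^+ 4) ^+ m]exprMn.
rewrite [leLHS](_ : _ = 2 ^+ j * j`!%:R * w ^+ 2 * (m`!%:R^-1 * (2 ^+ m * (w ^+ 4) ^+ m)))//.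
have : m`!%:R != 0 :> R by rewrite pnatr_eq0 -lt0n fact_gt0.
move: (m`!%:R) ((w ^+ 4) ^+ m) (2 ^+ m) (2 ^+ j) => F w4 two_m two_j F0.
by field.
Unshelve. all: by end_near. Qed.
End Asymptotics.

(** * Regularity and periodicity of the iterated derivatives *)

Section Derivatives.
Context {R : realType} (W V : R -> R).
Variables dW dV : {measure set (measurableTypeR R) -> \bar R}.
Hypothesis W_incr : forall x y, x < y -> W x < W y.
Hypothesis V_incr : forall x y, x < y -> V x < V y.
Hypothesis W_cadlag : cadlag W.
Hypothesis V_caglad : caglad V.
Hypothesis W_per : forall x, W (x + 1) - W x = W 1 - W 0.
Hypothesis V_per : forall x, V (x + 1) - V x = V 1 - V 0.
Hypothesis W0 : W 0 = 0.
Hypothesis V0 : V 0 = 0.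
Hypothesis dWE : stieltjes_oc W dW.
Hypothesis dVE : stieltjes_co V dV.
Variable f : R -> R.
Hypothesis f_Cinf : CinfWV W V dW dV f.

Let U := integrator W V.
Local Notation d n := (derivWV W V n f).

Let W_nd := ltW_homo W_incr.
Let V_nd := ltW_homo V_incr.
Let U_nd t a b : a <= b -> U t a <= U t b.
Proof. exact: integrator_nd. Qed.

Lemma integrator_regulated t : regulated (~~ t) (U t).
Proof. by case: t. Qed.

Lemma integrator_per t x : U t (x + 1) = U t x + (U t 1 - U t 0).
Proof. by case: t; have := W_per x; have := V_per x; rewrite /U /=; lra. Qed.

Lemma derivWVS (g : R -> R) n : derivWV W V n.+1 g =
  one_sided_derivative (~~ odd n) (U (~~ odd n)) (derivWV W V n g).
Proof. by rewrite /=; case: (odd n). Qed.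

Lemma derivableWVS (g : R -> R) n : derivableWV W V n.+1 g ->
  one_sided_derivable (~~ odd n) (U (~~ odd n)) (derivWV W V n g).
Proof. by move=> [_]; rewrite /=; case: (odd n). Qed.

Lemma quotient_wrt_addl (G g : R -> R) a :
  quotient_wrt G (fun x => a + g x) = quotient_wrt G g.
Proof. by apply/funext => x; apply/funext => h; congr (_ / _); ring. Qed.

Lemma derivWV_addl a (g : R -> R) n :
  derivWV W V n.+1 (fun x => a + g x) = derivWV W V n.+1 g.
Proof.
elim: n => [|n IHn]; last by rewrite derivWVS IHn -derivWVS.
by rewrite /= /left_derivative quotient_wrt_addl.
Qed.

Lemma deriv_regulated n : regulated (odd n) (d n).
Proof.
have [a [g [[_ gc _ Hg] ->]]] := f_Cinf; case: n => [x /=|n].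
  by have [gx gl] := gc x; split; [apply: cvgD => //; exact: cvg_cst|
    apply: is_cvgD => //; exact: is_cvg_cst].
by rewrite derivWV_addl; have [_] := Hg n.+1 isT; case: ifP => _ [].
Qed.

Lemma deriv_derivable n :
  one_sided_derivable (~~ odd n) (U (~~ odd n)) (d n).
Proof.
have [a [g [[_ gc _ Hg] ->]]] := f_Cinf; have [/derivableWVS + _] := Hg n.+1 isT.
case: n => [|n]; last by rewrite derivWV_addl.
by rewrite /= /left_derivable quotient_wrt_addl.
Qed.

Lemma deriv_periodic n x : d n (x + 1) = d n x.
Proof.
elim: n x => [|n IHn] x.
  by have [a [g [[gper _ _ _] ->]]] := f_Cinf; rewrite /= gper.
(* A unit translation adds the same constant to both values of [U t], so it cancels in the
   denominator. *)
have qE t : quotient_wrt (U t) (d n) (x + 1) = quotient_wrt (U t) (d n) x.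
  apply/funext => h; rewrite /quotient_wrt [x + 1 + h]addrAC !IHn !integrator_per.
  by congr (_ / _); ring.
by rewrite derivWVS; case: (~~ odd n);
  rewrite /one_sided_derivative /left_derivative /right_derivative qE.
Qed.

Lemma deriv_first_order n lo hi :
  first_order U (~~ odd n) lo hi (d n) (d n.+1).
Proof.
apply: mean_value_first_order; last first.
  by apply: regulated_small_osc; exact: (deriv_regulated n.+1).
move=> a b m M _ ab _; rewrite derivWVS => H.
have Ui x y : x < y -> U (~~ odd n) x < U (~~ odd n) y.
  by rewrite /U; case: (odd n); [exact: V_incr|exact: W_incr].
have reg : regulated (~~ ~~ odd n) (d n) by rewrite negbK; exact: deriv_regulated.
have Ureg := integrator_regulated (~~ odd n).
apply/andP; split.
  by apply: (one_sided_derivative_lb Ui Ureg reg (deriv_derivable n) ab) => x /H/andP[].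
by apply: (one_sided_derivative_ub Ui Ureg reg (deriv_derivable n) ab) => x /H/andP[].
Qed.

(** * Error estimate and passage to the limit *)

Section Estimate.
Variable c : nat -> R.
Hypothesis f_bound : forall n,
  (maxe (supnorm (d (2 * n))) (supnorm (d (2 * n + 1))) <= (c n)%:E)%E.

Lemma deriv_bound n x : 0 <= x <= 1 -> `|d n x| <= c n./2.
Proof.
(* The supremum norm only sees [0, 1[; the endpoint 1 is brought back to 0 by periodicity. *)
wlog x1 : x / x < 1 => [H /andP[x0 x1]|/andP[x0 _]].
  have [xl|xg] := ltP x 1; first by apply: H => //; rewrite x0 x1.
  have -> : x = 0 + 1 by rewrite add0r; apply/eqP; rewrite eq_le x1.
  by rewrite deriv_periodic; apply: H; rewrite ?lexx ?ltr01 ?ler01.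
have := f_bound n./2; rewrite ge_max => /andP[H0 H1].
have H m : (supnorm (d m) <= (c n./2)%:E)%E -> `|d m x| <= c n./2.
  move=> sup; rewrite -lee_fin; apply: le_trans sup; apply: ereal_sup_ubound.
  by exists x => //=; rewrite in_itv/= x0.
rewrite -{1}(odd_double_half n); case: (odd n); apply: H.
  by rewrite add1n -mul2n -addn1.
by rewrite add0n -mul2n.
Qed.

(** The maximum with 1 makes the powers of [w] nondecreasing in the exponent. *)
Let w := Num.max 1 (Num.max (W 1) (V 1)).

(** Exactly one of two consecutive steps has kind [t], so the induction carries [k] and [k.+1]
    together. *)
Lemma steps_ge p t k : (k./2 <= steps p t k <= k)%N.
Proof.
suff : (k./2 <= steps p t k <= k)%N && (k.+1./2 <= steps p t k.+1 <= k.+1)%N.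
  by case/andP.
elim: k => [|k /andP[IH1 IH2]].
  by rewrite /steps big_ord_recr/= !big_ord0/=; case: (_ == _).
rewrite IH2 /= /steps 2!big_ord_recr/= -/(steps _ _ _) sideS.
have : ((side p k == t) + (~~ side p k == t) = 1)%N by case: (side _ _); case: (t).
by move: IH1; lia.
Qed.

Lemma w_ge1 : 1 <= w. Proof. by rewrite le_max lexx. Qed.

(** The upper bound on [steps] controls the power, the lower bound the factorial. *)
Lemma step_weight_le_w p t k x : 0 <= x <= 1 ->
  0 <= step_weight U p x t k 0 <= w ^+ k / (k./2)`!%:R.
Proof.
move=> /andP[x0 x1].
have Ux0 : 0 <= U t x - U t 0 by rewrite subr_ge0 U_nd.
have Uxw : U t x - U t 0 <= w.
  have : U t 0 = 0 by case: (t).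
  move=> ->; rewrite subr0 (le_trans (U_nd t x1))//.
  by rewrite !le_max /U; case: (t); rewrite lexx !orbT.
have /andP[s1 s2] := steps_ge p t k.
rewrite divr_ge0 ?exprn_ge0//= ler_pM ?exprn_ge0 ?invr_ge0//.
  by rewrite (le_trans (lerXn2r _ _ _ Uxw)) ?nnegrE ?(le_trans ler01 w_ge1)// ler_weXn2l ?w_ge1.
by rewrite lef_pV2 ?posrE ?ltr0n ?fact_gt0// ler_nat leq_fact.
Qed.

(** Taylor's formula for the derivative of order [j], whose further derivatives begin with the
    integrator of kind [~~ odd j]. The remainder is bounded through the product of the [W] and [V]
    weights at 0. *)
Lemma gen_taylor_estimate j n x : 0 <= x <= 1 ->
  `|d j 0 + \sum_(1 <= k < n.+1)
      d (k + j) 0 * gen_poly W V dW dV (~~ odd j) k x x - d j x| <=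
  c (n.+1 + j)./2 * (w ^+ (n.+1).*2 / ((n.+1)./2`!%:R ^+ 2)).
Proof.
move=> /andP[x0 x1]; set p := ~~ odd j.
pose Phi := gen_poly_tail W V dW dV p x.
have mv k := gen_poly_tail_mean_value W_nd V_nd dWE dVE p x k.
have sideE k : side p k = ~~ odd (k + j) by rewrite /side oddD addNb addbC.
have Phi_ge0 k y : 0 <= y <= x -> 0 <= Phi k y.
  by move=> /andP[y0 yx]; have /andP[] := (mv k).1 y y y0 (lexx _) yx.
have Phi_le k y : 0 <= y <= x -> Phi k y <= Phi k 0.
  by move=> /andP[y0 yx]; have /andP[] := (mv k).1 0 y (lexx _) y0 yx.
have Phi_osc k : small_osc (side p k) 0 x (Phi k).
  case: k => [|k].
    move=> e e0; apply: finely_all => a b _ _ _ y _.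
    by rewrite /Phi /= subrr normr0 ltW.
  (* [Phi k.+1] inherits the regularity of the integrator it is built on, which is exactly what a
     density for the next, opposite integrator requires. *)
  rewrite sideS; apply: (mean_value_small_osc U_nd (C := Phi k 0)) (mv k).2 _.
  - by apply: Phi_ge0; rewrite lexx.
  - by move=> y yI; rewrite normrN ger0_norm ?Phi_ge0 ?Phi_le.
  - exact: integrator_regulated.
have Phi_fo k : first_order U (side p k) 0 x (Phi k.+1) (fun s => - Phi k s).
  by apply: mean_value_first_order (mv k).2 _; exact/small_oscN.
have d01 k y : 0 <= y <= x -> `|d k y| <= c k./2.
  by move=> /andP[y0 yx]; apply: deriv_bound; rewrite y0 (le_trans yx).
have c0 k : 0 <= c k./2 by apply: (le_trans _ (d01 k 0 _)); rewrite ?lexx.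
have bounded k : exists C, forall y, 0 <= y <= x -> `|d (k + j) y| <= C /\ `|Phi k y| <= C.
  exists (c (k + j)./2 + Phi k 0) => y yI; rewrite (ger0_norm (Phi_ge0 k y yI)).
  have P0 : 0 <= Phi k 0 by apply: Phi_ge0; rewrite lexx.
  by split; [rewrite ler_wpDr// d01|rewrite ler_wpDl// Phi_le].
have d_fo k : first_order U (side p k) 0 x (d (k + j)) (d (k.+1 + j)).
  by rewrite sideE addSn; exact: deriv_first_order.
have Phi0 y : Phi 0 y = 1 by [].
have PhiS k : Phi k.+1 0 = gen_poly W V dW dV p k.+1 x x.
  by rewrite /Phi /= gen_polyS0 // subr0.
have Phix k : Phi k.+1 x = 0 by rewrite /Phi /= subrr.
clearbody Phi.
have := @taylor_remainder _ U U_nd p 0 x Phi Phi0 Phi_ge0 Phi_fo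
  (fun k => d (k + j)) d_fo bounded n (c (n.+1 + j)./2) x0 (fun y => d01 _ y).
have U_left y : U false z @[z --> y^'-] --> U false y by have [] := V_caglad y.
have := Phi_ub U_nd Phi0 Phi_fo U_left Phi_osc Phix n.+1 (x := 0).
rewrite lexx x0 => /(_ isT) Phi_bd.
(* At the right end [x] only the term of index 0 survives, namely the derivative of order [j] at
   [x]; at 0 the tails are the diagonal values of the polynomials. *)
rewrite !big_ord_recl !Phi0 Phix subr0 !mulr1 big1 ?addr0; last first.
  by move=> i _; rewrite lift0 Phix mulr0.
rewrite distrC => H.
have -> : \sum_(1 <= k < n.+1) d (k + j) 0 * gen_poly W V dW dV p k x x =
    \sum_(i < n) d (lift ord0 i + j) 0 * Phi (lift ord0 i) 0.
  by rewrite big_add1 big_mkord; apply: eq_bigr => i _; rewrite lift0 PhiS.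
apply: (le_trans H); rewrite ler_wpM2l//; apply: (le_trans Phi_bd).
have /andP[t1 t2] := step_weight_le_w p true n.+1 (x := x) ltac:(by rewrite x0 x1).
have /andP[f1 f2] := step_weight_le_w p false n.+1 (x := x) ltac:(by rewrite x0 x1).
apply: (le_trans (ler_pM t1 f1 t2 f2)).
by rewrite mulrACA -exprD addnn -invfM -expr2.
Qed.
(** Being independent of [x], this bound gives uniform convergence. *)
Definition taylor_rate j n :=
  c (n.+1 + j)./2 * (w ^+ (n.+1).*2 / ((n.+1)./2`!%:R ^+ 2)).

Hypothesis c_o : c =o_\oo (fun n => n`!%:R / expR 1 ^+ n).

Lemma taylor_rate_cvg0 j : taylor_rate j n @[n --> \oo] --> 0.
Proof.
pose u n := c (n + j)./2 * (w ^+ n.*2 / (n./2`!%:R ^+ 2)).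
by rewrite (@cvg_shiftS _ u); exact: factorial_growth_cvg0 w_ge1 c_o.
Qed.

Lemma gen_taylor_uniform : {uniform `[0, 1[,
  (fun (N : nat) (x : R) =>
     f 0 + \sum_(1 <= k < N.+1) d k 0 * Fpoly W dW dV k x x) @ \oo --> f}.
Proof.
move=> P /uniform_nbhs[E [/= entE EP]].
have [e e0 eE] : exists2 e : R, 0 < e & forall a b : R, `|a - b| < e -> E (a, b).
  by move: entE; rewrite -entourage_ballE => -[e e0 He]; exists e => // a b ab; exact: He.
have /cvgrPdist_lt/(_ e e0) := taylor_rate_cvg0 0.
apply: filterS => n; rewrite sub0r normrN => rn.
apply: EP => x /=; rewrite in_itv/= => /andP[x0 x1]; apply: eE.
rewrite distrC; apply: le_lt_trans (le_lt_trans (ler_norm _) rn).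
have := gen_taylor_estimate 0 n (x := x); rewrite x0 ltW// => /(_ isT).
by move=> H; apply: le_trans H; under [in leRHS]eq_bigr do rewrite addn0.
Qed.

(** At x = 1 periodicity cancels the values of the derivative at 0 and at 1, so the Taylor error is
    the partial sum itself. *)
Lemma gen_poly_series_cvg0 j :
  \sum_(1 <= k < N.+1) d (k + j) 0 * gen_poly W V dW dV (~~ odd j) k 1 1
    @[N --> \oo] --> 0.
Proof.
apply: norm_cvg0; apply: (squeeze_cvgr _ (cvg_cst 0) (taylor_rate_cvg0 j)).
near=> n; rewrite normr_ge0 /=.
have := gen_taylor_estimate j n (x := 1); rewrite ler01 lexx => /(_ isT).
have -> : d j 1 = d j 0 by rewrite -(deriv_periodic j 0) add0r.
by rewrite addrAC subrr add0r.
Unshelve. all: by end_near. Qed.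
End Estimate.
End Derivatives.

Theorem theorem2p2p5 (R : realType) (W V : R -> R)
    (dW dV : {measure set (measurableTypeR R) -> \bar R})
    (W_incr : forall x y, x < y -> W x < W y)
    (V_incr : forall x y, x < y -> V x < V y)
    (W_cadlag : cadlag W) (V_caglad : caglad V)
    (W_per : forall x, W (x + 1) - W x = W 1 - W 0)
    (V_per : forall x, V (x + 1) - V x = V 1 - V 0)
    (W_cont0 : {for 0, continuous W}) (V_cont0 : {for 0, continuous V})
    (W0 : W 0 = 0) (V0 : V 0 = 0)
    (dWE : stieltjes_oc W dW) (dVE : stieltjes_co V dV)
    (f : R -> R) (f_Cinf : CinfWV W V dW dV f)
    (c : nat -> R)
    (f_bound : forall n,
      (maxe (supnorm (derivWV W V (2 * n) f))
            (supnorm (derivWV W V (2 * n + 1) f)) <= (c n)%:E)%E)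
    (c_o : c =o_\oo (fun n => n`!%:R / expR 1 ^+ n)) :
  [/\ {uniform `[0, 1[,
        (fun (N : nat) (x : R) =>
           f 0 + \sum_(1 <= k < N.+1) derivWV W V k f 0 * Fpoly W dW dV k x x)
        @ \oo --> f},
      forall j, ~~ odd j ->
        (\sum_(1 <= k < N.+1) derivWV W V (k + j) f 0 * Fpoly W dW dV k 1 1)
          @[N --> \oo] --> 0 &
      forall j, odd j ->
        (\sum_(1 <= k < N.+1) derivWV W V (k + j) f 0 * Gpoly V dW dV k 1 1)
          @[N --> \oo] --> 0].
Proof.
have series := gen_poly_series_cvg0 W_incr V_incr W_cadlag V_caglad W_per V_per
  W0 V0 dWE dVE f_Cinf f_bound c_o.
split.
- exact: (gen_taylor_uniform W_incr V_incr W_cadlag V_caglad W_per V_per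
    W0 V0 dWE dVE f_Cinf f_bound c_o).
- by move=> j jE; have := series j; rewrite jE.
- by move=> j jO; have := series j; rewrite jO.
Qed.
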